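(* Let $l>0$ be real and let $M,N$ be nonnegative integers with $M<N$. Put $p=\lfloor M/2\rfloor$, $p_1=\lfloor (M-1)/2\rfloor$, $q=\lfloor N/2\rfloor$, $q_1=\lfloor (N-1)/2\rfloor$. Let $V^{[M,N,l]}=\left(T^{[M,M,l]}\right)^{-1}T^{[M,N,l]}$ and denote by $v^{[M,N,l]}_{i,j}$ ($0\le i\le M$, $0\le j\le N$) its entries. Then: (1) for all integers $0\le m\le p$ and $p_1+1\le n\le q_1$: $v^{[M,N,l]}_{2m,2n+1}=0$; (2) for all integers $0\le m\le p_1$ and $p+1\le n\le q$: $v^{[M,N,l]}_{2m+1,2n}=0$; (3) for all integers $0\le m\le p$ and $p+1\le n\le q$: $$v^{[M,N,l]}_{2m,2n}=\frac{(-1)^{p-m}\,l^{2(n-m)}\,(2n)!}{2^{n-m}(n-m)!\,(p-m)!\,(2m)!}\ \prod_{r=n-p}^{n-m-1}r\ \prod_{r=p+m+1}^{p+n}\frac{1}{2r+1};$$ (4) for all integers $0\le m\le p_1$ and $p_1+1\le n\le q_1$: $$v^{[M,N,l]}_{2m+1,2n+1}=\frac{(-1)^{p_1-m}\,l^{2(n-m)}\,(2n+1)!}{2^{n-m}(n-m)!\,(p_1-m)!\,(2m+1)!}\ \prod_{r=n-p_1}^{n-m-1}r\ \prod_{r=p_1+m+2}^{p_1+n+1}\frac{1}{2r+1}.$$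
   Context: For $m\in\mathbb{N}=\{0,1,2,\dots\}$ the Legendre polynomial is $L_m(x)=\frac{1}{2^m m!}\frac{d^m}{dx^m}\left[(x^2-1)^m\right]$. For real $l>0$ set $e_{m,l}(X)=\sqrt{2m+1}\,L_m(X/l)$. For polynomials $A,B\in\mathbb{R}[X]$ set $\langle A,B\rangle_l=\frac{1}{2l}\int_{-l}^{l}A(x)B(x)\,dx$. For nonnegative integers $M\le N$, $T^{[M,N,l]}$ is the $(M+1)\times(N+1)$ real matrix, with rows indexed by $0\le m\le M$ and columns by $0\le n\le N$, with entries $T^{[M,N,l]}_{m,n}=\langle X^n,e_{m,l}\rangle_l$. The square matrix $T^{[M,M,l]}$ is invertible. Empty products equal $1$ and empty index ranges impose no condition. *)

(* Defs.v *)
From HB Require Import structures.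
From mathcomp Require Import all_boot all_order all_algebra.
From mathcomp Require Import all_classical all_reals all_analysis.

Set Implicit Arguments.
Unset Strict Implicit.
Unset Printing Implicit Defensive.

Import Order.TTheory GRing.Theory Num.Theory.
Import numFieldNormedType.Exports.

Local Open Scope classical_set_scope.
Local Open Scope ring_scope.

(* Rodrigues' formula. *)
Definition legendre (R : realType) (m : nat) : {poly R} :=
  (2 ^+ m * (m`!)%:R)^-1 *: (('X^2 - 1) ^+ m)^`(m).

Definition legendre_scaled (R : realType) (l : R) (m : nat) : {poly R} :=
  Num.sqrt (2 * m + 1)%:R *: (legendre R m \Po (l^-1 *: 'X)).

Definition mean_dot (R : realType) (l : R) (A B : {poly R}) : R :=
  (2 * l)^-1 *
  \int[@lebesgue_measure R]_(x in `[- l, l]) (A.[x] * B.[x]).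

Definition legendre_matrix (R : realType) (M N : nat) (l : R) :
    'M[R]_(M.+1, N.+1) :=
  \matrix_(m < M.+1, n < N.+1) mean_dot l 'X^n (legendre_scaled l m).

(* [invmx A] is the inverse of [A] because the square matrix
   [legendre_matrix M M l] is a unit for l > 0; on singular matrices [invmx]
   would be the identity function. *)
Definition projection_matrix (R : realType) (M N : nat) (l : R) :
    'M[R]_(M.+1, N.+1) :=
  invmx (legendre_matrix M M l) *m legendre_matrix M N l.

(* The entry in row i and column j, with indices counted from 0; only
   meaningful for i <= M and j <= N. *)
Definition projection_entry (R : realType) (M N : nat) (l : R) (i j : nat) : R :=
  projection_matrix M N l (inord i) (inord j).

(* floor((M - 1) / 2) as an integer: it is -1 for M = 0, which the truncated
   [M.-1./2] would turn into 0. *)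
Definition half_pred (M : nat) : int := ((M%:Z - 1) %/ 2)%Z.

(* Main.v *)
Require Import Defs.
From mathcomp Require Import all_boot all_order all_algebra.
From mathcomp Require Import all_classical all_reals all_analysis.
From mathcomp Require Import ring lra zify.

Set Implicit Arguments.
Unset Strict Implicit.
Unset Printing Implicit Defensive.

Import Order.TTheory GRing.Theory Num.Theory.
Import numFieldNormedType.Exports.

Local Open Scope ring_scope.

(** The column [j] of the matrix [V] holds the coefficients of the orthogonal
    projection of ['X^j] on the polynomials of degree at most [M], so it should
    be found from the monomials alone.  Indeed the row [m] of the Legendre
    matrix is the row of Legendre coefficients of degree at most [m] times the
    matrix [G] of the means of ['X^(i + j)] between [- l] and [l]; the matrix
    of Legendre coefficients is triangular with a nonzero diagonal, hence
    cancels, and [V] is the solution of [G_MM V = G_MN] ([projection_entry_system]).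

    Odd moments vanish, so the system splits into one system for the even rows
    and one for the odd rows ([moment_sum_parity]).  After a rescaling by
    powers of [l], each of them is a Cauchy system
    [\sum_a w_a / (x_a + t_c) = b / (y + t_c)] with
    [x_a = 2 a + s], [y = 2 n + s], [t_c = 2 c + s + 1], where the boolean [s]
    is the parity.  Cauchy systems are solved by counting the roots of one
    polynomial ([cauchy_system]).  With [b = 0] this gives the
    invertibility of [G_MM] and the two vanishing statements; with [b = 1] it
    gives the entries as products, which [cauchy_products] rewrites with
    factorials, the same way for both parities because
    [(2 n + s)! = 2^n n! (1 * 3 * ... * (2 (n + s) - 1))]. *)

(** * Moments on a symmetric interval *)

Lemma Rintegral_horner (R : realType) (a b : R) (P Q : {poly R}) :
  a < b -> Q^`() = P ->
  \int[@lebesgue_measure R]_(x in `[a, b]%classic) P.[x] = Q.[b] - Q.[a].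
Proof.
move=> ab dQ; rewrite /Rintegral (@continuous_FTC2 _ (horner P) (horner Q)) //.
- exact/continuous_subspaceT/continuous_horner.
- split=> [x _||]; first exact: derivable_horner.
  + exact/cvg_at_right_filter/continuous_horner.
  + exact/cvg_at_left_filter/continuous_horner.
- by move=> x _; rewrite -derivE dQ.
Qed.

(** The mean of [x ^+ n] for [x] between [- l] and [l]. *)
Definition moment (R : realType) (l : R) (n : nat) : R :=
  if odd n then 0 else l ^+ n / n.+1%:R.

(** The product ['X^n * B] has an explicit antiderivative, linear in the
    coefficients of [B]; the values at [l] and [- l] of its monomials of even
    degree cancel. *)
Lemma mean_dotXn (R : realType) (l : R) (n K : nat) (B : {poly R}) :
  0 < l -> (size B <= K)%N ->
  mean_dot l 'X^n B = \sum_(k < K) B`_k * moment l (n + k).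
Proof.
move=> l0 sB.
have BE : B = \sum_(k < K) B`_k *: 'X^k.
  apply/polyP => i; rewrite -poly_def coef_poly.
  by case: ltnP => // Ki; rewrite nth_default // (leq_trans sB).
pose Q : {poly R} := \sum_(k < K) (B`_k / (n + k).+1%:R) *: 'X^((n + k).+1).
have dQ : Q^`() = 'X^n * B.
  rewrite [in RHS]BE mulr_sumr /Q linear_sum.
  apply: eq_bigr => k _ /=.
  rewrite derivZ derivXn -[X in _ *: X]scaler_nat scalerA divfK ?pnatr_eq0 //=.
  by rewrite -scalerAr -exprD.
rewrite /mean_dot; under eq_Rintegral do rewrite -hornerM.
rewrite (Rintegral_horner _ dQ); last by lra.
rewrite /Q !horner_sum -sumrB mulr_sumr; apply: eq_bigr => k _.
rewrite !hornerE -mulrBr exprNn /moment -signr_odd /=.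
case: (odd (n + k)) => /=; rewrite ?expr0 ?expr1.
  by rewrite mul1r subrr !mulr0.
rewrite exprS.
have := lt0r_neq0 l0; have : (n + k).+1%:R != 0 :> R by rewrite pnatr_eq0.
move: ((n + k).+1%:R : R) => z z0 ln.
by field; apply/andP.
Qed.

(** * Factorization of the Legendre matrix *)

(** The coefficient of degree [m] is a nonzero multiple of the leading
    coefficient of the monic polynomial [('X^2 - 1) ^+ m]. *)
Lemma size_legendre (R : realType) (m : nat) : size (legendre R m) = m.+1.
Proof.
have mon : ('X^2 - 1 : {poly R}) ^+ m \is monic.
  by apply: monic_exp; exact: monicXnsubC.
have sz : size (('X^2 - 1 : {poly R}) ^+ m) = (m + m).+1.
  rewrite -[LHS]prednK ?size_exp; last by rewrite size_poly_gt0 monic_neq0.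
  by rewrite size_XnsubC // mul2n addnn.
apply/eqP; rewrite eqn_leq; apply/andP; split.
  apply/leq_sizeP => k mk; rewrite coefZ coef_derivn.
  by rewrite nth_default ?mul0rn ?mulr0 // sz; lia.
rewrite ltnNge; apply/negP => /leq_sizeP/(_ m (leqnn m)).
rewrite coefZ coef_derivn; move/monicP: mon; rewrite lead_coefE sz /= => ->.
apply/eqP; rewrite -mulr_natr mul1r mulf_eq0 invr_eq0 mulf_eq0 expf_eq0.
rewrite !pnatr_eq0 andbF /= negb_or -!lt0n fact_gt0 ffact_gt0.
exact: leq_addr.
Qed.

Lemma size_legendre_scaled (R : realType) (l : R) (m : nat) :
  l != 0 -> size (legendre_scaled l m) = m.+1.
Proof.
move=> l0; rewrite size_scale; last first.
  by rewrite gt_eqF // sqrtr_gt0 ltr0n addn1.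
by rewrite size_comp_poly2 ?size_legendre // size_scale ?size_polyX // invr_eq0.
Qed.

Definition legendre_coef_mx (R : realType) (l : R) (M : nat) : 'M[R]_M.+1 :=
  \matrix_(m, k) (legendre_scaled l m)`_k.

Definition moment_mx (R : realType) (l : R) (M N : nat) : 'M[R]_(M.+1, N.+1) :=
  \matrix_(k, n) moment l (n + k).

Lemma legendre_matrixE (R : realType) (l : R) (M N : nat) : 0 < l ->
  legendre_matrix M N l = legendre_coef_mx l M *m moment_mx l M N.
Proof.
move=> l0; apply/matrixP => m n; rewrite !mxE (@mean_dotXn _ _ _ M.+1) //.
  by apply: eq_bigr => k _; rewrite !mxE.
by rewrite size_legendre_scaled ?lt0r_neq0.
Qed.

(** Triangular, because the row [m] comes from a polynomial of degree [m]. *)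
Lemma legendre_coef_mx_unit (R : realType) (l : R) (M : nat) : 0 < l ->
  legendre_coef_mx l M \in unitmx.
Proof.
move=> l0; have l_neq0 := lt0r_neq0 l0; rewrite unitmxE det_trig.
  rewrite unitfE; apply/prodf_neq0 => m _; rewrite mxE.
  have sz := size_legendre_scaled m l_neq0.
  have : lead_coef (legendre_scaled l m) != 0.
    by rewrite lead_coef_eq0 -size_poly_gt0 sz.
  by rewrite lead_coefE sz.
by apply/is_trig_mxP => m k mk; rewrite mxE nth_default // size_legendre_scaled.
Qed.

(** * Cauchy systems *)

(** After multiplication by [\prod_a (u + x a) * (u + y)], the difference of the
    two sides of the system, seen as a function of [u = t c], becomes a
    polynomial [Q] of degree at most [K] that vanishes at the [K] points
    [t c].  It is thus proportional to [Z = \prod_c ('X - t c)], and evaluating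
    at [- y], where [Q] does not depend on [w], and at [- x m], where it only
    depends on [w m], gives [w m]. *)
Lemma cauchy_system (F : fieldType) (K : nat) (x t w : 'I_K -> F) (y b : F) :
  injective x -> injective t ->
  (forall a c, x a + t c != 0) -> (forall c, y + t c != 0) ->
  (forall a, x a != y) ->
  (forall c, \sum_a w a / (x a + t c) = b / (y + t c)) ->
  forall m, w m = b * \prod_c ((x m + t c) / (y + t c)) *
                  \prod_(a | a != m) ((x a - y) / (x a - x m)).
Proof.
move=> injx injt xt0 yt0 xy0 sys m.
pose P' i : {poly F} := \prod_(a | a != i) ('X + (x a)%:P).
pose Q : {poly F} := b *: \prod_a ('X + (x a)%:P)
  - ('X + y%:P) * \sum_a w a *: P' a.
pose Z : {poly F} := \prod_c ('X - (t c)%:P).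
have size_P (A : pred 'I_K) :
    size (\prod_(a | A a) ('X + (x a)%:P)) = #|A|.+1.
  rewrite -big_filter (eq_bigr (fun a => 'X - (- x a)%:P)) => [|a _].
    by rewrite size_prod_XsubC -sum1_card -sum1_size big_filter.
  by rewrite polyCN opprK.
have size_Q : (size Q <= K.+1)%N.
  rewrite (leq_trans (size_polyD _ _)) // geq_max size_polyN; apply/andP; split.
    by rewrite (leq_trans (size_scale_leq _ _)) // size_P card_ord.
  rewrite (leq_trans (size_polyMleq _ _)) // size_XaddC /= ltnS.
  rewrite (leq_trans (size_sum _ _ _)) //; apply/bigmax_leqP => a _.
  rewrite (leq_trans (size_scale_leq _ _)) // size_P cardC1 card_ord prednK //.
  exact: leq_ltn_trans (ltn_ord a).
have size_Z : (size Z = K.+1)%N.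
  by rewrite size_prod_XsubC -sum1_size sum1_card card_ord.
have Q_root c : Q.[t c] = 0.
  rewrite !hornerE horner_prod horner_sum.
  have := sys c.
  have -> : \sum_a (w a *: P' a).[t c] =
      (\sum_a w a / (x a + t c)) * \prod_a ('X + (x a)%:P).[t c].
    rewrite mulr_suml; apply: eq_bigr => a _; rewrite hornerZ horner_prod.
    rewrite [in RHS](bigD1 a) //= hornerD hornerX hornerC [t c + _]addrC.
    by rewrite -mulrA mulKf.
  move=> ->; rewrite [t c + y]addrC.
  by field.
have Z_root c : Z.[t c] = 0.
  rewrite horner_prod (bigD1 c) //= !hornerE; ring.
have Qy : Q.[- y] = b * \prod_a (x a - y).
  rewrite !hornerE addNr mul0r subr0 horner_prod; congr (_ * _).
  by apply: eq_bigr => a _; rewrite !hornerE addrC.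
have Qx : Q.[- x m] = (x m - y) * (w m * \prod_(a | a != m) (x a - x m)).
  rewrite hornerD hornerN hornerZ hornerM horner_prod (bigD1 m) //=.
  rewrite !hornerD hornerX hornerC addNr mul0r mulr0 sub0r.
  rewrite horner_sum (bigD1 m) //= big1 => [|a am].
    rewrite hornerZ horner_prod addr0.
    under eq_bigr do rewrite !hornerE addrC.
    by rewrite hornerC -mulNr opprD opprK.
  rewrite hornerZ horner_prod (bigD1 m) ?(eq_sym m) //=.
  by rewrite hornerD hornerX hornerC addNr mul0r mulr0.
have ZN u : Z.[- u] = (- 1) ^+ K * \prod_c (u + t c).
  rewrite horner_prod.
  under eq_bigr do rewrite !hornerE -opprD -mulN1r.
  by rewrite big_split /= prodr_const card_ord.
(* [Z.[- y]] is nonzero, so this is proportionality; both sides agree at the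
   [K + 1] distinct points [- y] and [t c], and have degree at most [K]. *)
have HE : Z.[- y] *: Q = Q.[- y] *: Z.
  apply/eqP; rewrite -subr_eq0; apply/eqP.
  apply: (@roots_geq_poly_eq0 _ _ (- y :: [seq t c | c <- enum 'I_K])).
  - rewrite /= /root hornerD hornerN !hornerZ [_ * Z.[_]]mulrC subrr eqxx /=.
    apply/allP => _ /mapP[c _ ->]; rewrite /root hornerD hornerN !hornerZ.
    by rewrite Q_root Z_root !mulr0 subrr.
  - rewrite /= (map_inj_uniq injt) enum_uniq andbT.
    apply/mapP => -[c _ yt]; have := yt0 c; rewrite -yt subrr eqxx //.
  - rewrite /= size_map -cardE card_ord (leq_trans (size_polyD _ _)) //.
    rewrite geq_max size_polyN (leq_trans (size_scale_leq _ _)) //=.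
    by rewrite (leq_trans (size_scale_leq _ _)) // size_Z.
have := congr1 (fun p => p.[- x m]) HE.
rewrite !hornerZ Qx Qy !ZN (bigD1 m (F := fun a => x a - y)) //= => E.
rewrite !big_split /= !prodfV.
have xmy : x m - y != 0 by rewrite subr_eq0.
have py : \prod_c (y + t c) != 0 by apply/prodf_neq0 => c _.
have pm : \prod_(a | a != m) (x a - x m) != 0.
  by apply/prodf_neq0 => a; rewrite subr_eq0 (inj_eq injx).
have s0 : (-1) ^+ K != 0 :> F by rewrite signr_eq0.
move: s0 xmy py pm E.
move: (w m) (_ ^+ K) (_ - y) (\prod_c (y + t c)) (\prod_(a | _) (x a - x m)).
move=> wm s d py pm s0 d0 py0 pm0 E.
(* Multiplying by the denominators turns the goal into [E], the relation [HE]
   evaluated at [- x m]. *)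
apply: (mulfI (mulf_neq0 (mulf_neq0 s0 d0) (mulf_neq0 py0 pm0))).
transitivity (s * py * (d * (wm * pm))); first by ring.
by rewrite E; field; apply/andP.
Qed.

(** * Separation of parities *)

(** [(n + ~~ s)./2] is the number of [i < n] of parity [s]; for [n = M + 1] it
    is [floor (M / 2) + 1] when [s] is false and [floor ((M - 1) / 2) + 1] when
    [s] is true. *)
Lemma sum_parity (V : nmodType) (s : bool) (n : nat) (F : nat -> V) :
  \sum_(0 <= i < n | odd i == s) F i =
  \sum_(0 <= a < (n + ~~ s)./2) F (2 * a + s)%N.
Proof.
elim: n => [|n IHn]; first by case: s; rewrite !big_geq.
have -> : (n.+1 + ~~ s)./2 = ((n + ~~ s)./2 + (odd n == s))%N.
  by case: s {IHn} => /=; lia.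
rewrite big_mkcond big_nat_recr //= -big_mkcond IHn.
case: eqP => [ns|_]; last by rewrite addn0 addr0.
rewrite addn1 big_nat_recr //=; congr (_ + F _); case: s ns {IHn} => /=; lia.
Qed.

Lemma ltn_half_parity (s : bool) (M a : nat) :
  (a < (M.+1 + ~~ s)./2)%N = (2 * a + s <= M)%N.
Proof. case: s => /=; lia. Qed.

(** The unknowns [l ^+ (2 a + s) * v (2 a + s)] satisfy a Cauchy system once the
    equation [c] is divided by [l ^+ (2 c + s)].  The bound [K <= n] keeps
    [2 n + s] apart from the nodes [2 a + s].  Homogeneous systems are the case
    [b = 0], for instance with [n = K]. *)
Lemma parity_system (R : realType) (l b : R) (s : bool) (K n : nat)
    (v : nat -> R) :
  0 < l -> (K <= n)%N ->
  (forall c, (c < K)%N ->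
     \sum_(0 <= a < K) v (2 * a + s)%N * moment l ((2 * a + s) + (2 * c + s))
     = b * moment l ((2 * n + s) + (2 * c + s))) ->
  forall m, (m < K)%N ->
  v (2 * m + s)%N = b * l ^+ (2 * (n - m)) *
    (\prod_(0 <= c < K)
       ((2 * (c + (m + s)) + 1)%:R / (2 * (c + (n + s)) + 1)%:R)) *
    \prod_(0 <= a < K | a != m) ((n%:R - a%:R) / (m%:R - a%:R)).
Proof.
move=> l0 Kn sys m mK.
pose x (i : nat) : R := (2 * i + s)%:R.
pose w (i : 'I_K) := l ^+ (2 * i + s) * v (2 * i + s)%N.
pose t (i : 'I_K) : R := (2 * i + s + 1)%:R.
have xt (i : nat) c : x i + t c = (2 * (c + (i + s)) + 1)%:R.
  by rewrite /x /t -natrD; congr (_%:R); lia.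
have nat_inj (i j : nat) : i%:R = j%:R :> R -> i = j.
  by move/eqP; rewrite eqr_nat => /eqP.
have ln0 k : l ^+ k != 0 by rewrite expf_neq0 // lt0r_neq0.
have xt0 (i : nat) c : x i + t c != 0 by rewrite xt pnatr_eq0 addn1.
have momentE i (c : 'I_K) : moment l ((2 * i + s) + (2 * c + s)) =
    l ^+ (2 * c + s) * (l ^+ (2 * i + s) / (x i + t c)).
  rewrite /moment ifF; last by lia.
  rewrite addnC exprD -mulrA; congr (_ * _).
  by congr (_ / _); rewrite xt; congr (_%:R); lia.
have w_sys c : \sum_a w a / (x a + t c) = b * l ^+ (2 * n + s) / (x n + t c).
  apply: (mulfI (ln0 (2 * c + s)%N)).
  transitivity (b * moment l ((2 * n + s) + (2 * c + s))); last first.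
    by rewrite momentE mulrCA [b * (_ / _)]mulrA.
  rewrite -sys // mulr_sumr big_mkord; apply: eq_bigr => a _.
  by rewrite momentE /w [l ^+ _ * v _]mulrC -mulrA [RHS]mulrCA.
have injx : injective (fun i : 'I_K => x i).
  by move=> i j /nat_inj ij; apply: val_inj => /=; lia.
have injt : injective t.
  by move=> i j /nat_inj ij; apply: val_inj => /=; lia.
have xy0 (a : 'I_K) : x a != x n.
  by rewrite eqr_nat; have := ltn_ord a; lia.
have E :=
  cauchy_system injx injt (fun a => xt0 a) (xt0 n) xy0 w_sys (Ordinal mK).
apply: (mulfI (ln0 (2 * m + s)%N)); rewrite [LHS]E /= !mulrA.
have -> : l ^+ (2 * m + s) * b * l ^+ (2 * (n - m)) = b * l ^+ (2 * n + s).
  by rewrite mulrAC -exprD mulrC; congr (_ * _ ^+ _); lia.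
rewrite !big_mkord; congr (_ * _ * _).
  by apply: eq_bigr => c _; rewrite -!xt.
apply: eq_bigr => a; rewrite -val_eqE /= => am.
have am0 : m%:R - a%:R != 0 :> R by rewrite subr_eq0 eqr_nat eq_sym.
have am1 : x a - x m != 0 by rewrite subr_eq0 eqr_nat; lia.
apply/eqP; rewrite eqr_div //; apply/eqP.
rewrite /x ![(_ + s)%:R]natrD !natrM; ring.
Qed.

(** * Closed form of the products *)

(** The double factorial of [2 a - 1]. *)
Definition odd_prod (R : realType) (a : nat) : R :=
  \prod_(0 <= c < a) (2 * c + 1)%:R.

Lemma odd_prod_neq0 (R : realType) a : odd_prod R a != 0.
Proof.
rewrite prodf_seq_neq0; apply/allP => c _; rewrite pnatr_eq0; lia.
Qed.

Lemma odd_prodD (R : realType) a k :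
  odd_prod R (a + k) = odd_prod R a * \prod_(0 <= c < k) (2 * (c + a) + 1)%:R.
Proof.
rewrite /odd_prod (big_cat_nat (leq0n a) (leq_addr k a)) /=.
by rewrite -{2}[a]add0n big_addn addKn.
Qed.

Lemma fact_odd_prod (R : realType) (s : bool) n :
  ((2 * n + s)`!)%:R = 2 ^+ n * (n`!)%:R * odd_prod R (n + s).
Proof.
have even_case k : ((2 * k)`!)%:R = 2 ^+ k * (k`!)%:R * odd_prod R k.
  elim: k => [|k IHk]; first by rewrite /odd_prod big_geq // mul1r mulr1.
  have -> : (2 * k.+1 = (2 * k).+2)%N by lia.
  have two_k : (2 * k).+2%:R = 2 * k.+1%:R :> R.
    by rewrite -natrM; congr (_%:R); lia.
  rewrite !factS natrM two_k 2!natrM IHk /odd_prod big_nat_recr //= exprS.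
  by rewrite addn1; ring.
case: s; rewrite ?addn0 ?even_case //.
rewrite !addn1 factS natrM even_case /odd_prod big_nat_recr //= addn1; ring.
Qed.

(** The factors with [a < m] give [m!], and the [d] negative ones with [a > m]
    give [d!] up to sign. *)
Lemma prod_natB_ne (R : realType) (m d : nat) :
  \prod_(0 <= a < (m + d).+1 | a != m) (m%:R - a%:R) =
  (-1) ^+ d * (m`!)%:R * (d`!)%:R :> R.
Proof.
rewrite big_mkcond; elim: d => [|d IHd].
  rewrite addn0 big_nat_recr //= eqxx mulr1 mul1r mulr1 -ffactnn ffact_prod.
  rewrite natr_prod big_mkord; apply: eq_bigr => i _.
  by rewrite ifT ?natrB // ?ltn_eqF // ltnW.
rewrite addnS big_nat_recr //= IHd factS natrM exprS ifT; last by lia.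
have -> : (m + d).+1%:R = m%:R + d.+1%:R :> R by rewrite -natrD addnS.
ring.
Qed.

Lemma prod_natB (R : realType) (n K : nat) : (K <= n)%N ->
  (\prod_(0 <= a < K) (n%:R - a%:R)) * ((n - K)`!)%:R = (n`!)%:R :> R.
Proof.
move=> Kn; rewrite -(ffact_fact Kn) natrM ffact_prod natr_prod big_mkord.
congr (_ * _); apply: eq_bigr => i _; rewrite natrB //.
by rewrite (leq_trans _ Kn) // ltnW.
Qed.

Lemma prod_nat_fact (R : realType) (a b : nat) : (a <= b)%N ->
  (a`!)%:R * (\prod_(a.+1 <= r < b.+1) r%:R) = (b`!)%:R :> R.
Proof.
move=> ab; rewrite !fact_prod !natr_prod.
by rewrite [RHS](big_cat_nat (n := a.+1)).
Qed.

(** All the products are monomials in factorials, odd products, powers of [2],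
    a sign and [n - m] (with exponents of either sign), and so are the
    factorials of [2 n + s] and [2 m + s]; what is left is an identity between
    two such monomials. *)
Lemma cauchy_products (R : realType) (s : bool) (k n m : nat) :
  (m <= k)%N -> (k < n)%N ->
  (\prod_(0 <= c < k.+1)
     ((2 * (c + (m + s)) + 1)%:R / (2 * (c + (n + s)) + 1)%:R)) *
  \prod_(0 <= a < k.+1 | a != m) ((n%:R - a%:R) / (m%:R - a%:R)) =
  (-1) ^+ (k - m) * ((2 * n + s)`!)%:R /
  (2 ^+ (n - m) * ((n - m)`!)%:R * ((k - m)`!)%:R * ((2 * m + s)`!)%:R) *
  (\prod_(n - k <= r < n - m) r%:R) *
  \prod_(k + m + 1 + s <= r < k + n + 1 + s) (1 / (2 * r%:R + 1)) :> R.
Proof.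
move=> mk kn.
have fact0 j : (j`!)%:R != 0 :> R by rewrite pnatr_eq0 -lt0n fact_gt0.
have odd0 := odd_prod_neq0 R.
have nm0 : n%:R - m%:R != 0 :> R.
  by rewrite subr_eq0 eqr_nat; lia.
have A i : \prod_(0 <= c < k.+1) (2 * (c + (i + s)) + 1)%:R =
    odd_prod R (k + i + 1 + s) / odd_prod R (i + s).
  have -> : (k + i + 1 + s = i + s + k.+1)%N by lia.
  by rewrite odd_prodD mulrC mulKf.
have X : \prod_(0 <= a < k.+1 | a != m) (n%:R - a%:R) =
    (n`!)%:R / (n - k.+1)`!%:R / (n%:R - m%:R) :> R.
  rewrite -(@prod_natB R n k.+1) // mulfK // (bigD1_seq m) ?iota_uniq //=.
    by rewrite mulrC mulKf.
  by rewrite mem_index_iota.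
have Y : \prod_(0 <= a < k.+1 | a != m) (m%:R - a%:R) =
    (-1) ^+ (k - m) * (m`!)%:R * ((k - m)`!)%:R :> R.
  by rewrite -prod_natB_ne subnKC.
have P : \prod_(n - k <= r < n - m) r%:R =
    ((n - m.+1)`!)%:R / ((n - k.+1)`!)%:R :> R.
  rewrite -(@prod_nat_fact R (n - k.+1) (n - m.+1)); last by lia.
  rewrite mulrC mulKf //; congr (bigop _ (index_iota _ _) _); lia.
have Z : \prod_(k + m + 1 + s <= r < k + n + 1 + s) (1 / (2 * r%:R + 1)) =
    odd_prod R (k + m + 1 + s) / odd_prod R (k + n + 1 + s).
  have kmn : (k + m + 1 + s <= k + n + 1 + s)%N by lia.
  rewrite /odd_prod (big_cat_nat (leq0n _) kmn) /= -/(odd_prod _ _).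
  rewrite invfM mulVKf // -prodfV; apply: eq_bigr => r _.
  by rewrite div1r natrD natrM.
have nm_fact : ((n - m)`!)%:R = (n%:R - m%:R) * ((n - m.+1)`!)%:R :> R.
  have -> : (n - m = (n - m.+1).+1)%N by lia.
  by rewrite factS natrM; congr (_ * _); rewrite -natrB; [congr (_%:R)|]; lia.
have pow2 : 2 ^+ n = 2 ^+ (n - m) * 2 ^+ m :> R.
  by rewrite -exprD; congr (_ ^+ _); lia.
rewrite P Z !big_split /= !prodfV !A X Y nm_fact !fact_odd_prod pow2.
have two0 j : 2 ^+ j != 0 :> R by rewrite expf_neq0 // pnatr_eq0.
have sg0 : (-1) ^+ (k - m) != 0 :> R by rewrite signr_eq0.
(* The sign is in a denominator on the left, from [Y], and in a numerator on the
   right. *)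
rewrite -[in RHS](invr_sign R (k - m)); move: sg0.
move: (fact0 m) (fact0 n) (fact0 (k - m)%N) (fact0 (n - m.+1)%N).
move: (fact0 (n - k.+1)%N) (odd0 (k + m + 1 + s)%N) (odd0 (k + n + 1 + s)%N).
move: (odd0 (m + s)%N) (odd0 (n + s)%N) (two0 m) (two0 (n - m)%N) nm0.
move: (n%:R - m%:R) (2 ^+ m) (2 ^+ (n - m)) (_ ^+ (k - m)).
move: (odd_prod R (k + m + 1 + s)) (odd_prod R (k + n + 1 + s)).
move: (odd_prod R (m + s)) (odd_prod R (n + s)).
move: (m`!%:R) (n`!%:R) ((k - m)`!%:R) ((n - m.+1)`!%:R) ((n - k.+1)`!%:R).
move=> a1 a2 a3 a4 a5 a6 a7 a8 a9 c1 c2 c3 sg *.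
field.
by do ?[apply/andP; split].
Qed.

(** * The system satisfied by the projection matrix *)

(** In the row [2 c + s], the moments of the columns of parity other than [s]
    are zero. *)
Lemma moment_sum_parity (R : realType) (l : R) (s : bool) (M : nat)
    (v b : nat -> R) :
  (forall k, (k <= M)%N ->
     \sum_(0 <= i < M.+1) v i * moment l (i + k) = b k) ->
  forall c, (c < (M.+1 + ~~ s)./2)%N ->
  \sum_(0 <= a < (M.+1 + ~~ s)./2)
    v (2 * a + s)%N * moment l ((2 * a + s) + (2 * c + s)) =
  b (2 * c + s)%N.
Proof.
move=> sys c; rewrite ltn_half_parity => cM; rewrite -sys //.
rewrite -(sum_parity _ _ (fun i => v i * moment l (i + (2 * c + s)))).
rewrite big_mkcond; apply: eq_bigr => i _; case: eqP => // /eqP is_s.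
by rewrite /moment ifT ?mulr0 //; case: s is_s {cM}; lia.
Qed.

(** A homogeneous system on one parity class has only the zero solution there,
    whatever the right-hand sides on the other class; this serves both for the
    invertibility of the moment matrix and for the entries that vanish. *)
Lemma moment_system0 (R : realType) (l : R) (s : bool) (M : nat)
    (v b : nat -> R) : 0 < l ->
  (forall k, (k <= M)%N ->
     \sum_(0 <= i < M.+1) v i * moment l (i + k) = b k) ->
  (forall c, b (2 * c + s)%N = 0) ->
  forall m, (2 * m + s <= M)%N -> v (2 * m + s)%N = 0.
Proof.
move=> l0 sys b0 m mM; set K := ((M.+1 + ~~ s)./2).
rewrite (@parity_system R l 0 s K K v l0) ?ltn_half_parity ?mul0r //.
by move=> c cK; rewrite (moment_sum_parity sys) // b0 mul0r.
Qed.

(** A vector of the left kernel vanishes on each parity class. *)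
Lemma moment_mx_unit (R : realType) (l : R) (M : nat) : 0 < l ->
  moment_mx l M M \in unitmx.
Proof.
move=> l0; rewrite -row_free_unit; apply: inj_row_free => v vG0.
pose f i := v 0 (inord i).
have sys k : (k <= M)%N -> \sum_(0 <= i < M.+1) f i * moment l (i + k) = 0.
  move=> kM; transitivity ((v *m moment_mx l M M) 0 (inord k)).
    rewrite mxE big_mkord; apply: eq_bigr => i _.
    by rewrite !mxE /f inord_val inordK // addnC.
  by rewrite vG0 mxE.
apply/rowP => i; rewrite mxE -[i]inord_val -/(f i) -[X in f X]odd_double_half.
rewrite addnC -mul2n (@moment_system0 _ l _ M f (fun=> 0)) //.
by rewrite mul2n addnC odd_double_half -ltnS.
Qed.

(** Both Legendre matrices have the matrix of Legendre coefficients as left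
    factor, and it cancels. *)
Lemma projection_entry_system (R : realType) (l : R) (M N j : nat) :
  0 < l -> (j <= N)%N -> forall k, (k <= M)%N ->
  \sum_(0 <= i < M.+1) projection_entry M N l i j * moment l (i + k) =
  moment l (j + k).
Proof.
move=> l0 jN k kM.
have GV : moment_mx l M M *m projection_matrix M N l = moment_mx l M N.
  have T_unit : legendre_matrix M M l \in unitmx.
    rewrite legendre_matrixE // unitmx_mul.
    by rewrite legendre_coef_mx_unit ?moment_mx_unit.
  apply: (can_inj (mulKmx (legendre_coef_mx_unit M l0))).
  by rewrite mulmxA -!legendre_matrixE // mulKVmx.
transitivity (moment_mx l M N (inord k) (inord j)); last first.
  by rewrite mxE !inordK.
rewrite -GV [RHS]mxE big_mkord; apply: eq_bigr => i _.
by rewrite [moment_mx _ _ _ _ _]mxE /projection_entry inord_val inordK // mulrC.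
Qed.

(** * Entries of the projection matrix *)

(** The right-hand side of the equations of parity [s] consists of odd
    moments. *)
Lemma projection_entry_parity (R : realType) (l : R) (s : bool)
    (M N m j : nat) :
  0 < l -> (2 * m + s <= M)%N -> (j <= N)%N -> odd j != s ->
  projection_entry M N l (2 * m + s) j = 0.
Proof.
move=> l0 mM jN js.
apply: (moment_system0 l0 (projection_entry_system l0 jN) _ mM) => c.
by rewrite /moment ifT //; case: s js {mM}; lia.
Qed.

Lemma projection_entry_value (R : realType) (l : R) (s : bool)
    (M N k m n : nat) :
  0 < l -> (k.+1 = (M.+1 + ~~ s)./2)%N ->
  (m <= k)%N -> (k < n)%N -> (2 * n + s <= N)%N ->
  projection_entry M N l (2 * m + s) (2 * n + s) =
  ((-1) ^+ (k - m) * l ^+ (2 * (n - m)) * ((2 * n + s)`!)%:R) /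
  (2 ^+ (n - m) * ((n - m)`!)%:R * ((k - m)`!)%:R * ((2 * m + s)`!)%:R) *
  (\prod_(n - k <= r < n - m) r%:R) *
  \prod_(k + m + 1 + s <= r < k + n + 1 + s) (1 / (2 * r%:R + 1)).
Proof.
move=> l0 kE mk kn nN.
have sys := moment_sum_parity (s := s) (projection_entry_system (M := M) l0 nN).
rewrite -kE in sys.
rewrite (@parity_system R l 1 s k.+1 n
  (projection_entry M N l ^~ (2 * n + s)%N)) //.
  by rewrite -mulrA cauchy_products // mul1r !mulrA [_ * l ^+ _]mulrC.
by move=> c cK; rewrite mul1r sys.
Qed.

Lemma half_predE (M : nat) : half_pred M = (uphalf M)%:Z - 1.
Proof. rewrite /half_pred; lia. Qed.

Theorem theorem4p2 (R : realType) (l : R) (hl : 0 < l) (M N : nat)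
    (hMN : (M < N)%N) :
  let p : nat := M./2 in
  let p1 : int := half_pred M in
  let q : nat := N./2 in
  let q1 : int := half_pred N in
  let v : nat -> nat -> R := projection_entry M N l in
  [/\ forall m n : nat, (m <= p)%N -> p1 + 1 <= n%:Z <= q1 ->
        v (2 * m)%N (2 * n + 1)%N = 0,
      forall m n : nat, m%:Z <= p1 -> (p + 1 <= n <= q)%N ->
        v (2 * m + 1)%N (2 * n)%N = 0,
      forall m n : nat, (m <= p)%N -> (p + 1 <= n <= q)%N ->
        v (2 * m)%N (2 * n)%N =
          ((-1) ^+ (p - m) * l ^+ (2 * (n - m)) * ((2 * n)`!)%:R) /
          (2 ^+ (n - m) * ((n - m)`!)%:R * ((p - m)`!)%:R * ((2 * m)`!)%:R) *
          (\prod_(n - p <= r < n - m) r%:R) *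
          \prod_(p + m + 1 <= r < p + n + 1) (1 / (2 * r%:R + 1))
    & forall m n : nat, m%:Z <= p1 -> p1 + 1 <= n%:Z <= q1 ->
        (* here p1 >= m >= 0, so its absolute value k is p1 itself *)
        let k : nat := `|p1|%N in
        v (2 * m + 1)%N (2 * n + 1)%N =
          ((-1) ^+ (k - m) * l ^+ (2 * (n - m)) * ((2 * n + 1)`!)%:R) /
          (2 ^+ (n - m) * ((n - m)`!)%:R * ((k - m)`!)%:R
             * ((2 * m + 1)`!)%:R) *
          (\prod_(n - k <= r < n - m) r%:R) *
          \prod_(k + m + 2 <= r < k + n + 2) (1 / (2 * r%:R + 1))].
Proof.
move=> p p1 q q1 v.
rewrite {}/p1 {}/q1 !half_predE /v /p /q => {v p q}.
split=> [m n mp|m n mp1|m n mp|m n mp1] /andP[pn nq].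
- by rewrite -[(2 * m)%N]addn0 (@projection_entry_parity R l false) //; lia.
- by rewrite (@projection_entry_parity R l true) //; lia.
- rewrite -[(2 * m)%N]addn0 -[(2 * n)%N]addn0 -[(_ + m + 1)%N]addn0.
  rewrite -[(_ + n + 1)%N]addn0.
  by apply: (@projection_entry_value R l false) => //=; lia.
- have add2 i : (i + 2 = i + 1 + 1)%N by lia.
  rewrite !add2.
  by apply: (@projection_entry_value R l true) => //=; lia.
Qed.
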